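(* Let $s\ge 2$ be an integer, and let $\mathcal{F}\subseteq 2^{[n]}$ be an $s$-saturated family. Then $$|\mathcal{F}|\;\ge\;\left(1-\frac{1}{\,s+(s-2)\frac{\log n}{2\sqrt{5}\,n}\,}\right)\cdot 2^n .$$
   Context: Here $n$ is a positive integer, $[n]=\{1,2,\dots,n\}$, and $2^{[n]}$ is the family of all subsets of $[n]$. A matching of size $s$ consists of $s$ pairwise disjoint sets. For an integer $s\ge 2$, a family $\mathcal{F}\subseteq 2^{[n]}$ is called $s$-saturated if it contains no $s$ pairwise disjoint sets, and moreover no set can be added to $\mathcal{F}$ while preserving this property. The symbol $\log$ is the logarithm (its base is not specified in the source) that appears in the Kahn-Kalai-Linial theorem in the form used there: if $f:\{0,1\}^n\to\{0,1\}$ takes the value $1$ with probability $p\le \tfrac12$ under the uniform measure, then $\sum_{i=1}^n I_f(x_i)^2\ge \frac{p^2\log^2 n}{5n}$, where $I_f(x_i)$ is the probability that, after fixing all coordinates other than $i$ uniformly at random, changing $x_i$ changes the value of $f$.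
   Formalization: Adds s+(s-2)log n/(2√5 n) ≤ 2^n: a saturated family omits the empty set (disjoint from itself), so has at most 2^n-1 sets, and otherwise the bound always fails (n=1, s=3, F={{1}}: 1 < 4/3). The logarithm is taken as natural. *)

(* Defs.v *)
From mathcomp Require Import all_boot all_order all_algebra.
From mathcomp Require Import all_classical all_reals all_analysis.

Set Implicit Arguments.
Unset Strict Implicit.
Unset Printing Implicit Defensive.

(* The ground set [n] is 'I_n.  A matching of size s is an indexed family
   A_1, ..., A_s of pairwise disjoint sets.  Nonempty pairwise disjoint sets
   are automatically distinct, so the indexing only matters for the empty set,
   which is disjoint from itself: a family containing it has matchings of
   every size.  Requiring the A_i to be distinct instead would make {set0} a
   2-saturated family of size 1, against the known bound |F| >= 2^(n-1). *)
Definition has_matching (n s : nat) (F : {set {set 'I_n}}) : Prop :=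
  exists A : 'I_s -> {set 'I_n},
    (forall i, A i \in F) /\ (forall i j, i != j -> [disjoint A i & A j]).

Definition saturated (n s : nat) (F : {set {set 'I_n}}) : Prop :=
  ~ has_matching s F /\
  (forall B : {set 'I_n}, B \notin F -> has_matching s (B |: F)).

(* Main.v *)
Require Import Defs.
From mathcomp Require Import all_boot all_order all_algebra.
From mathcomp Require Import all_classical all_reals all_analysis.
From mathcomp Require Import fintype finset zify ring lra.

(* Write G for the complement of an s-saturated family F; F is an up-set, and
   B is in G exactly when F contains s - 1 pairwise disjoint sets avoiding B.
   Fix a coordinate i and let F0, F1 be the two restrictions of F, with
   complements G0, G1.  The tuple (F1, F0, ..., F0) is again cross-saturated:
   the complement of a set of G1 contains s - 1 disjoint sets of F0, that of a
   set of G0 contains s - 2 of them.  For up-sets A and B, disjoint occurrence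
   satisfies |A box B| <= |{X in A : the complement of X is in B}|, so each of
   the s - 1 successive disjoint occurrences of F0 loses at least |G0| sets;
   hence |G1| + (s - 1) |G0| <= 2^n when F0, F1 are seen as families on [n].
   As |G0| + |G1| = 2 |G| and |G0| - |G1| is the number of sets for which i is
   pivotal, this reads s |G| + (s - 2) Piv_i / 2 <= 2^n, and it remains to
   choose i of large influence by the Kahn-Kalai-Linial theorem. *)

Import Order.TTheory GRing.Theory Num.Theory.
Local Open Scope ring_scope.
Set Implicit Arguments.
Unset Strict Implicit.
Unset Printing Implicit Defensive.

(** * Splitting sums over subsets along one coordinate *)

Section SubsetSplit.
Variables (T : finType) (R : Type) (idx : R) (op : Monoid.com_law idx).

Lemma big_subsetU1 (f : {set T} -> R) (D : {set T}) i : i \notin D ->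
  \big[op/idx]_(X : {set T} | X \subset i |: D) f X
    = \big[op/idx]_(X : {set T} | X \subset D) op (f X) (f (i |: X)).
Proof.
move=> iD; rewrite (bigID (fun X : {set T} => i \in X)) /= Monoid.mulmC big_split /=.
congr (op _ _).
  apply: eq_bigl => X; apply/andP/idP => [[sX iX]|sX].
    apply/subsetP=> x xX; have := subsetP sX x xX.
    by rewrite !inE => /predU1P[xi|//]; rewrite -xi xX in iX.
  rewrite subsetU ?sX ?orbT //; split=> //.
  by apply: contra iD; exact: subsetP.
rewrite (reindex_onto (fun X => i |: X) (fun X => X :\ i)) /=; last first.
  by move=> X /andP[_ iX]; rewrite setD1K.
apply: eq_bigl => X; rewrite setU11 andbT.
apply/andP/idP => [[sX /eqP <-]|sX].
  by rewrite subDset.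
have iX : i \notin X by apply: contra iD; exact: subsetP.
by rewrite setUS // setU1K.
Qed.

Lemma big_set_split (f : {set T} -> R) i :
  \big[op/idx]_(X : {set T}) f X
    = \big[op/idx]_(X : {set T} | i \notin X) op (f X) (f (i |: X)).
Proof.
rewrite (eq_bigl (fun X : {set T} => X \subset i |: ~: [set i])); last first.
  by move=> X; rewrite setUCr subsetT.
rewrite big_subsetU1 ?setC11 //; apply: eq_bigl => X.
by rewrite subsetC sub1set inE.
Qed.

End SubsetSplit.

(** * Disjoint occurrence of up-sets *)

Section DisjointOccurrence.
Variable T : finType.
Implicit Types (A B F : {set {set T}}) (X Y U K : {set T}) (k : nat).
Local Open Scope nat_scope.

Definition upset F := forall X Y, X \subset Y -> X \in F -> Y \in F.

(** [B] receives the whole remainder [X :\: U]; for an up-set [B] this amounts to asking for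
    disjoint subsets of [X], one in [A] and one in [B]. *)
Definition box A B : {set {set T}} :=
  [set X : {set T} | [exists U : {set T}, [&& U \subset X, U \in A & X :\: U \in B]]].

Definition boxpow F k : {set {set T}} := iter k (box F) [set: {set T}].

Lemma boxP A B X :
  reflect (exists U, [/\ U \subset X, U \in A & X :\: U \in B]) (X \in box A B).
Proof.
rewrite inE; apply: (iffP existsP) => -[U].
  by case/and3P; exists U.
by case=> *; exists U; apply/and3P.
Qed.

Lemma box_upset A B : upset B -> upset (box A B).
Proof.
move=> upB X Y sXY /boxP[U [sUX AU BXU]]; apply/boxP; exists U; split=> //.
  exact: subset_trans sXY.
exact: upB (setSD U sXY) BXU.
Qed.

Lemma boxpow_upset F k : upset (boxpow F k).
Proof.
elim: k => [|k IHk]; last exact: box_upset.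
by move=> X Y _ _; rewrite inE.
Qed.

Lemma boxpow_dec F k : boxpow F k.+1 \subset boxpow F k.
Proof.
apply/subsetP=> X /boxP[U [_ _]].
exact: boxpow_upset (subsetDl X U).
Qed.

Lemma boxpow_leq F j k : j <= k -> boxpow F k \subset boxpow F j.
Proof.
elim: k => [|k IHk]; first by rewrite leqn0 => /eqP->.
rewrite leq_eqVlt => /predU1P[-> //|/IHk]; exact: subset_trans (boxpow_dec F k).
Qed.

(* Coordinates in [K] obey the rule defining A :&: (complements of B): a
   coordinate goes to A if it lies in X and to B if not.  The others obey the
   rule defining [box]: those in X are shared out, the rest are unused. *)
Definition hybrid A B K : {set {set T}} :=
  [set X : {set T} | [exists U : {set T},
    [&& U \subset X :\: K, (X :&: K) :|: U \in A
      & (K :\: X) :|: ((X :\: K) :\: U) \in B]]].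

Lemma hybridP A B K X :
  reflect (exists U, [/\ U \subset X :\: K, (X :&: K) :|: U \in A
                       & (K :\: X) :|: ((X :\: K) :\: U) \in B])
    (X \in hybrid A B K).
Proof.
rewrite inE; apply: (iffP existsP) => -[U].
  by case/and3P; exists U.
by case=> *; exists U; apply/and3P.
Qed.

Lemma hybrid0 A B : hybrid A B set0 = box A B.
Proof.
apply/setP=> X; rewrite !inE; apply: eq_existsb => U.
by rewrite setD0 setI0 set0D !set0U.
Qed.

Definition compl_mem A : {set {set T}} := [set X : {set T} | ~: X \in A].

Lemma card_compl_mem A : #|compl_mem A| = #|A|.
Proof.
rewrite -(card_imset (mem A) (inv_inj (@setCK T))).
apply: eq_card => X; rewrite inE; apply/idP/imsetP => [AX|[Y AY ->]].
  by exists (~: X); rewrite ?setCK.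
by rewrite setCK.
Qed.

Lemma hybridT A B : hybrid A B [set: T] = A :&: compl_mem B.
Proof.
apply/setP=> X; rewrite [in RHS]inE [X in _ && X]inE.
apply/hybridP/andP => [[U]|[AX BX]].
  rewrite setDT subset0 set0D setIT setU0 setTD.
  by case=> /eqP-> ; rewrite setU0.
by exists set0; rewrite sub0set setIT setU0 setDT set0D setU0 setTD.
Qed.

Lemma card_sum (P : {set {set T}}) : #|P| = \sum_(X : {set T}) (X \in P).
Proof. by rewrite -sum1_card big_mkcond; apply: eq_bigr => X _; case: ifP. Qed.

Lemma hybrid_step A B K i : upset A -> upset B -> i \notin K ->
  #|hybrid A B K| <= #|hybrid A B (i |: K)|.
Proof.
move=> upA upB iK; rewrite !card_sum !(big_set_split _ _ i).
apply: leq_sum => X iX.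
have or : (i |: X \in hybrid A B K) ->
    (i |: X \in hybrid A B (i |: K)) || (X \in hybrid A B (i |: K)).
  case/hybridP=> U [sU AU BU]; case: (boolP (i \in U)) => iU; apply/orP.
    left; apply/hybridP; exists (U :\ i); split.
    + apply/subsetP=> x; rewrite !inE => /andP[xi xU].
      by move/subsetP: sU => /(_ x xU); rewrite !inE (negbTE xi).
    + apply: upA AU; apply/subsetP=> x; rewrite !inE.
      by case: eqP => //= _; case: (x \in X); case: (x \in K); case: (x \in U).
    + apply: upB BU; apply/subsetP=> x; rewrite !inE.
      by case: (eqVneq x i) => [->|_] /=; rewrite ?iU ?andbF //=
         ?(negbTE iK) //=.
  right; apply/hybridP; exists U; split.
  + apply/subsetP=> x xU; move/subsetP: sU => /(_ x xU); rewrite !inE.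
    by case: (eqVneq x i) xU => [->|_] //=; rewrite (negbTE iU).
  + apply: upA AU; apply/subsetP=> x; rewrite !inE.
    by case: (eqVneq x i) => [->|_] //=; rewrite (negbTE iK) (negbTE iU).
  + apply: upB BU; apply/subsetP=> x; rewrite !inE.
    by case: (eqVneq x i) => [->|_] //=; rewrite (negbTE iX).
have and1 : (X \in hybrid A B K) -> (i |: X \in hybrid A B (i |: K)).
  case/hybridP=> U [sU AU BU]; apply/hybridP; exists U; split.
  + apply/subsetP=> x xU; move/subsetP: sU => /(_ x xU); rewrite !inE.
    by case: (eqVneq x i) => [->|_] //=; rewrite (negbTE iX) andbF.
  + apply: upA AU; apply/subsetP=> x; rewrite !inE.
    by case: (eqVneq x i) => [->|_] //=.
  + apply: upB BU; apply/subsetP=> x; rewrite !inE.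
    by case: (eqVneq x i) => [->|_] //=; rewrite (negbTE iX) (negbTE iK) andbF.
have and2 : (X \in hybrid A B K) -> (X \in hybrid A B (i |: K)).
  case/hybridP=> U [sU AU BU]; apply/hybridP; exists U; split.
  + apply/subsetP=> x xU; move/subsetP: sU => /(_ x xU); rewrite !inE.
    by case: (eqVneq x i) => [->|_] //=; rewrite (negbTE iX) andbF.
  + apply: upA AU; apply/subsetP=> x; rewrite !inE.
    by case: (eqVneq x i) => [->|_] //=; rewrite (negbTE iX).
  + apply: upB BU; apply/subsetP=> x; rewrite !inE.
    by case: (eqVneq x i) => [->|_] //=; rewrite (negbTE iX) (negbTE iK) andbF.
move: or and1 and2.
case: (X \in hybrid A B K); case: (i |: X \in hybrid A B K);
case: (X \in hybrid A B (i |: K)); case: (i |: X \in hybrid A B (i |: K));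
by move=> h1 h2 h3 //; case: (h1 isT) || case: (h2 isT) || case: (h3 isT).
Qed.

(** Let [K] grow from [set0] to [[set: T]] one coordinate at a time; the hybrid families never
    shrink in cardinality. *)
Lemma card_box_le A B : upset A -> upset B ->
  #|box A B| <= #|A :&: compl_mem B|.
Proof.
move=> upA upB; rewrite -hybrid0 -hybridT.
have [m] := ubnP #|[set: T]|; move: [set: T] => K.
elim: m K => // m IHm K; rewrite ltnS => leK.
have [-> //|[i iK]] := set_0Vmem K.
apply: (leq_trans (IHm (K :\ i) _)); first by rewrite (cardsD1 i) iK in leK.
by rewrite -[in leqRHS](setD1K iK) hybrid_step // setD11.
Qed.

(** By hypothesis [~: F] lies in [compl_mem (boxpow F k)], so the intersection with [F] in
    [card_box_le] costs exactly [#|~: F|] sets. *)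
Lemma boxpow_card_step F k : upset F ->
    (forall X, X \notin F -> ~: X \in boxpow F k) ->
  #|boxpow F k.+1| + #|~: F| <= #|boxpow F k|.
Proof.
move=> upF coF.
have upP := @boxpow_upset F k.
have := card_box_le upF upP.
set Q := compl_mem (boxpow F k).
have subQ : ~: F \subset Q.
  by apply/subsetP=> X; rewrite !inE => /coF.
rewrite -(card_compl_mem (boxpow F k)) -/Q -(cardsID F Q) [Q :&: F]setIC => le1.
suff -> : Q :\: F = ~: F by rewrite leq_add2r.
by rewrite setDE; apply/setIidPr.
Qed.

(** The hypothesis passes to every smaller exponent, as [boxpow] is decreasing, so the loss recurs
    at each step. *)
Lemma boxpow_card F k : upset F ->
    (forall X, X \notin F -> ~: X \in boxpow F k) ->
  #|boxpow F k.+1| + k.+1 * #|~: F| <= 2 ^ #|T|.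
Proof.
move=> upF coF.
suff le_j j : j <= k.+1 -> #|boxpow F j| + j * #|~: F| <= 2 ^ #|T| by exact: le_j.
elim: j => [|j IHj] ltj; first by rewrite mul0n addn0 /= -powersetT card_powerset cardsT.
have := IHj (ltnW ltj); apply: leq_trans.
rewrite mulSn addnA leq_add2r; apply: boxpow_card_step => // X /coF.
exact/subsetP/boxpow_leq.
Qed.

(** Restrictions remain families on [T], with membership independent of [i]; this doubles their
    sizes, whence the 2 in [restrict_card]. *)
Definition restrict0 i F : {set {set T}} := [set X : {set T} | X :\ i \in F].
Definition restrict1 i F : {set {set T}} := [set X : {set T} | i |: X \in F].

Lemma restrict0_upset i F : upset F -> upset (restrict0 i F).
Proof. by move=> upF X Y sXY; rewrite !inE; exact/upF/setSD. Qed.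

Lemma boxpow_restrict0 i F k Y : i \notin Y ->
  Y \in boxpow F k -> Y \in boxpow (restrict0 i F) k.
Proof.
elim: k Y => [|k IHk] Y iY; first by rewrite !inE.
case/boxP=> U [sUY FU PYU]; apply/boxP; exists U; split=> //.
  by rewrite inE (setDidPl _) // disjoint_sym disjoints1 (contra (subsetP sUY i)).
by apply: IHk; rewrite // inE (negbTE iY) andbF.
Qed.

(** At most one of [k + 1] disjoint sets contains [i], so discarding one leaves [k] sets that avoid
    [i]. *)
Lemma boxpow_restrict0U1 i F k Y :
  i |: Y \in boxpow F k.+1 -> Y \in boxpow (restrict0 i F) k.
Proof.
elim: k Y => [|k IHk] Y; first by rewrite !inE.
case/boxP=> U [sUY FU PYU]; case: (boolP (i \in U)) => iU.
  apply: (@boxpow_upset _ k.+1 ((i |: Y) :\: U)).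
    apply/subsetP=> x; rewrite !inE => /andP[xU /predU1P[xi|//]].
    by rewrite xi iU in xU.
  by apply: boxpow_restrict0 => //; rewrite inE iU.
apply/boxP; exists U; split.
- apply/subsetP=> x xU; have := subsetP sUY x xU.
  by rewrite !inE => /predU1P[xi|//]; rewrite xi (negbTE iU) in xU.
- by rewrite inE (setDidPl _) // disjoint_sym disjoints1.
- apply: IHk; rewrite [_ |: _](_ : _ = (i |: Y) :\: U) //.
  by apply/setP=> x; rewrite !inE; case: eqP => // ->; rewrite iU.
Qed.

Lemma boxpow_restrict1 i F k Y :
  Y :\ i \in boxpow F k -> Y \in boxpow (restrict0 i F) k.
Proof.
move=> PY; apply: (boxpow_upset (subsetDl Y [set i])).
by apply: boxpow_restrict0; rewrite ?setD11.
Qed.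

Definition pivotal i F : {set {set T}} :=
  [set X : {set T} | (X :\ i \in F) != (i |: X \in F)].

Lemma restrict_card i F : #|restrict0 i F| + #|restrict1 i F| = 2 * #|F|.
Proof.
rewrite !card_sum !(big_set_split _ _ i) -big_split big_distrr /=.
apply: eq_bigr => X iX; rewrite !inE setUA setUid setU1K //.
have -> : X :\ i = X by apply/setDidPl; rewrite disjoint_sym disjoints1.
by case: (X \in F); case: (i |: X \in F).
Qed.

Lemma pivotal_card i F : upset F ->
  #|restrict1 i F| = #|restrict0 i F| + #|pivotal i F|.
Proof.
move=> upF; rewrite !card_sum -big_split; apply: eq_bigr => X _ /=.
rewrite !inE; have := upF (X :\ i) (i |: X).
have -> : X :\ i \subset i |: X by rewrite subsetU // subsetDl orbT.
by case: (X :\ i \in F); case: (i |: X \in F) => // /(_ isT isT).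
Qed.

Lemma pivotal_setC i F : pivotal i (~: F) = pivotal i F.
Proof.
by apply/setP=> X; rewrite !inE; case: (_ \in F); case: (_ \in F).
Qed.

Lemma pivotal_bound i F s : upset F -> 2 <= s ->
    (forall X, (X \in F) = (~: X \notin boxpow F s.-1)) ->
  s * (2 * #|~: F|) + (s - 2) * #|pivotal i F| <= 2 * 2 ^ #|T|.
Proof.
case: s => [|[|s]] // upF _ satF; rewrite subn2 /=.
have up0 := restrict0_upset (i:=i) upF.
(* [s] is now the original value minus 2. The complement of [X :\ i] holds [s + 1] disjoint members
   of [F], one of which may use [i]. *)
have co0 X : X \notin restrict0 i F -> ~: X \in boxpow (restrict0 i F) s.
  rewrite inE satF negbK setCD => h; apply: boxpow_restrict0U1.
  by rewrite setUC.
have := boxpow_card up0 co0.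
have sub1 : ~: restrict1 i F \subset compl_mem (boxpow (restrict0 i F) s.+1).
  apply/subsetP=> X; rewrite in_setC inE satF negbK setCU setIC -setDE => h.
  by rewrite inE; exact: boxpow_restrict1.
have := subset_leq_card sub1; rewrite card_compl_mem.
have := restrict_card i F.
have := pivotal_card i upF; have := cardsC F.
have := cardsC (restrict0 i F); have := cardsC (restrict1 i F).
have -> : #|{set T}| = 2 ^ #|T| by rewrite -(cardsT {set T}) -powersetT card_powerset cardsT.
set f := #|F|; set g := #|~: F|; set p := #|pivotal _ _|; set N := 2 ^ #|T|.
set r0 := #|restrict0 i F|; set r1 := #|restrict1 i F|.
set g0 := #|~: restrict0 i F|; set g1 := #|~: restrict1 i F|.
move=> c1 c0 cF piv tot sub le0.
(* After these substitutions the claim is exactly twice [g1 + (s + 1) * g0 <= N]. *)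
have -> : 2 * g = 2 * g1 + p by lia.
have e0 : g0 = g1 + p by lia.
clearbody f g p N r0 r1 g0 g1; subst g0; nia.
Qed.

End DisjointOccurrence.

(** * From saturation to the complement condition *)

Section Saturation.
Variable n : nat.
Implicit Types (F : {set {set 'I_n}}) (X B : {set 'I_n}).
Local Open Scope nat_scope.

Lemma boxpow_matching F k X :
  X \in boxpow F k <-> exists A : 'I_k -> {set 'I_n},
    [/\ forall i, A i \in F, forall i j, i != j -> [disjoint A i & A j]
      & forall i, A i \subset X].
Proof.
elim: k X => [|k IHk] X.
  by rewrite inE; split=> // _; exists (fun=> set0); split=> [[]|[]|[]].
split=> [/boxP[U [sUX FU /IHk[A [FA dA sA]]]]|[A [FA dA sA]]].
  exists (fun i => oapp A U (unlift ord0 i)).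
  have dU j : [disjoint U & A j].
    rewrite disjoint_sym; apply: disjointWl (sA j) _.
    by rewrite -setI_eq0 setIDAC setDIl setDv setI0.
  split=> [i|i j|i].
  - by case: unliftP => [i'|] _ //=.
  - case: unliftP => [i'|] ->; case: unliftP => [j'|] -> //=.
    + by move=> ne; apply: dA; apply: contraNneq ne => ->.
    + by rewrite disjoint_sym dU.
  - case: unliftP => [i'|] _ //=; exact: subset_trans (sA i') (subsetDl X U).
apply/boxP; exists (A ord0); split=> //.
apply/IHk; exists (fun i => A (lift ord0 i)); split=> // [i j ne|i].
  by apply: dA; rewrite (inj_eq lift_inj).
by rewrite subsetD sA /= dA // eq_sym neq_lift.
Qed.

(** In a matching created by adding [Y], replacing [Y] by its subset [X] would give a matching
    inside [F]. *)
Lemma saturated_upset s F : saturated s F -> upset F.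
Proof.
move=> [noM satM] X Y sXY FX; apply: contraT => /satM[A [FA dA]].
have sub i : (if A i == Y then X else A i) \subset A i.
  by case: eqP => // ->.
case: noM; exists (fun i => if A i == Y then X else A i); split=> [i|i j ne].
  by have := FA i; rewrite in_setU1; case: eqP.
exact: disjointW (sub i) (sub j) (dA i j ne).
Qed.

Lemma saturated_set0 s F : saturated s F -> set0 \notin F.
Proof.
move=> [noM _]; apply/negP=> F0; case: noM; exists (fun=> set0).
by split=> // i j _; rewrite -setI_eq0 setI0.
Qed.

(* The only missing set for which saturation may fail to give a matching using
   it exactly once is [set0]; a second missing set takes care of that case. *)
Lemma saturated_compl s F B : saturated s.+1 F -> B != set0 -> B \notin F ->
  forall X, (X \in F) = (~: X \notin boxpow F s).
Proof.
move=> satF nzB nFB.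
have compl Y : Y != set0 -> Y \notin F -> ~: Y \in boxpow F s.
  move=> nzY nFY; case: satF => noM /(_ Y nFY)[A [FA dA]].
  have [j Aj|noY] := pickP (fun j => A j == Y); last first.
    case: noM; exists A; split=> // i.
    by have := FA i; rewrite in_setU1 noY.
  apply/boxpow_matching; exists (fun i => A (lift j i)); split=> [i|i i' ne|i].
  - have := FA (lift j i); rewrite in_setU1 => /predU1P[AY|//].
    have := dA _ _ (neq_lift j i); rewrite AY (eqP Aj) -setI_eq0 setIid.
    by rewrite (negbTE nzY).
  - by apply: dA; rewrite (inj_eq lift_inj).
  - rewrite -disjoints_subset -(eqP Aj); apply: dA.
    by rewrite eq_sym neq_lift.
move=> X; apply/idP/idP => [FX|]; last first.
  apply: contraR => nFX; have [X0|nzX] := eqVneq X set0; last exact: compl.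
  by apply: (boxpow_upset _ (compl B nzB nFB)); rewrite X0 setC0 subsetT.
apply/negP=> PX; case: satF => noM _; apply: noM.
have /boxpow_matching[A [FA dA _]] : [set: 'I_n] \in boxpow F s.+1.
  by apply/boxP; exists X; rewrite subsetT FX setTD.
by exists A.
Qed.

Lemma saturated_influence_bound s F B i : 2 <= s -> saturated s F ->
    B != set0 -> B \notin F ->
  s * (2 * #|~: F|) + (s - 2) * #|pivotal i F| <= 2 * 2 ^ n.
Proof.
case: s => // s hs satF nzB nFB; rewrite -[n in leqRHS]card_ord.
apply: pivotal_bound => //; first exact: saturated_upset satF.
exact: saturated_compl satF nzB nFB.
Qed.

End Saturation.

(** * Influences *)

Section Hypercontractivity.
Variables (R : rcfType) (T : finType).
Implicit Types (u v : {set T} -> R) (D X Y : {set T}).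

(** The one-coordinate case with equal functions: the form [2 1; 1 2] at [(a ^+ 3, b ^+ 3)] is twice
    the sum squared here. The difference vanishes to fourth order at [a = b]. *)
Lemma two_point_norm (a b : R) : 0 <= a -> 0 <= b ->
  8 * (a ^+ 6 + a ^+ 3 * b ^+ 3 + b ^+ 6) ^+ 2 <= 9 * (a ^+ 4 + b ^+ 4) ^+ 3.
Proof.
move=> a0 b0; rewrite -subr_ge0.
have -> : 9 * (a ^+ 4 + b ^+ 4) ^+ 3
    - 8 * (a ^+ 6 + a ^+ 3 * b ^+ 3 + b ^+ 6) ^+ 2
  = (a - b) ^+ 4 * (a ^+ 8 + 4 * (a ^+ 7 * b) + 9 * (a ^+ 6 * b ^+ 2)
      + 4 * (a ^+ 5 * b ^+ 3) + (a ^+ 3 * b - a * b ^+ 3) ^+ 2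
      + 4 * (a ^+ 3 * b ^+ 5) + 9 * (a ^+ 2 * b ^+ 6) + 4 * (a * b ^+ 7)
      + b ^+ 8) by ring.
apply: mulr_ge0; first by rewrite exprn_even_ge0.
by repeat apply: addr_ge0; rewrite ?sqr_ge0 ?mulr_ge0 ?exprn_ge0 ?mulr_ge0 ?exprn_ge0.
Qed.

(** The one-coordinate case for two functions, raised to the fourth power; Cauchy-Schwarz reduces it
    to [two_point_norm]. *)
Lemma two_point_form (a b c d : R) :
    0 <= a -> 0 <= b -> 0 <= c -> 0 <= d ->
  4 * (2 * (a ^+ 3 * c ^+ 3) + a ^+ 3 * d ^+ 3 + b ^+ 3 * c ^+ 3
        + 2 * (b ^+ 3 * d ^+ 3)) ^+ 4
    <= 81 * ((a ^+ 4 + b ^+ 4) ^+ 3 * (c ^+ 4 + d ^+ 4) ^+ 3).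
Proof.
move=> a0 b0 c0 d0.
pose Q (x y : R) := x ^+ 6 + x ^+ 3 * y ^+ 3 + y ^+ 6.
have Q0 x y : 0 <= x -> 0 <= y -> 0 <= Q x y.
  by move=> x0 y0; rewrite /Q !addr_ge0 ?mulr_ge0 ?exprn_ge0.
set S := _ + _ + _ + _; set P1 := (_ + _) ^+ 3; set P2 := (_ + _) ^+ 3.
(* Cauchy-Schwarz for the positive definite form [2 1; 1 2] *)
have CS : S ^+ 2 <= 4 * (Q a b * Q c d).
  rewrite -subr_ge0.
  have -> : 4 * (Q a b * Q c d) - S ^+ 2
      = 3 * (a ^+ 3 * d ^+ 3 - b ^+ 3 * c ^+ 3) ^+ 2 by rewrite /Q /S; ring.
  by rewrite mulr_ge0 ?sqr_ge0.
have h1 : 8 * Q a b ^+ 2 <= 9 * P1 := two_point_norm a0 b0.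
have h2 : 8 * Q c d ^+ 2 <= 9 * P2 := two_point_norm c0 d0.
have h12 : (8 * Q a b ^+ 2) * (8 * Q c d ^+ 2) <= (9 * P1) * (9 * P2).
  by apply: ler_pM => //; rewrite mulr_ge0 ?sqr_ge0.
have h4 : (S ^+ 2) ^+ 2 <= (4 * (Q a b * Q c d)) ^+ 2.
  by rewrite ler_pXn2r ?nnegrE ?sqr_ge0 ?mulr_ge0 ?Q0.
have -> : 4 * S ^+ 4 = 4 * (S ^+ 2) ^+ 2 by ring.
apply: (@le_trans _ _ (4 * (4 * (Q a b * Q c d)) ^+ 2)); first by rewrite ler_pM2l.
have -> : 4 * (4 * (Q a b * Q c d)) ^+ 2
  = (8 * Q a b ^+ 2) * (8 * Q c d ^+ 2) by ring.
by apply: le_trans h12 _; rewrite le_eqVlt; apply/orP; left; apply/eqP; ring.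
Qed.

Definition root4 (x : R) : R := Num.sqrt (Num.sqrt x).

Lemma root4_ge0 x : 0 <= root4 x. Proof. exact: sqrtr_ge0. Qed.

Lemma root4K x : 0 <= x -> root4 x ^+ 4 = x.
Proof.
by move=> x0; rewrite -[4%N]/(2 * 2)%N exprM /root4 sqr_sqrtr ?sqrtr_ge0 // sqr_sqrtr.
Qed.

(* The kernel of the noise operator with parameter 1/3, up to the factor
   (2/3) ^ #|D| *)
Definition noise D X Y : R := \prod_(i in D) (if (i \in X) == (i \in Y) then 2 else 1).

Lemma noiseU1 D i X Y : i \notin D ->
  noise (i |: D) X Y = (if (i \in X) == (i \in Y) then 2 else 1) * noise D X Y.
Proof. by move=> iD; rewrite /noise big_setU1. Qed.

Lemma noise_setU1l D i X Y : i \notin D -> noise D (i |: X) Y = noise D X Y.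
Proof.
move=> iD; apply: eq_bigr => j jD; rewrite !inE.
by case: (eqVneq j i) jD iD => // -> ->.
Qed.

Lemma noise_setU1r D i X Y : i \notin D -> noise D X (i |: Y) = noise D X Y.
Proof.
move=> iD; apply: eq_bigr => j jD; rewrite !inE.
by case: (eqVneq j i) jD iD => // -> ->.
Qed.

(* Two-function hypercontractivity, <f, N g> <= |f|_(4/3) |g|_(4/3), written
   for f = u ^+ 3 and g = v ^+ 3 and without normalising the measure. *)
Lemma hypercontractive D u v : (forall X, 0 <= u X) -> (forall X, 0 <= v X) ->
  \sum_(X : {set T} | X \subset D) \sum_(Y : {set T} | Y \subset D)
      u X ^+ 3 * v Y ^+ 3 * noise D X Y
    <= Num.sqrt (9 / 2) ^+ #|D|
       * (root4 (\sum_(X : {set T} | X \subset D) u X ^+ 4) ^+ 3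
          * root4 (\sum_(X : {set T} | X \subset D) v X ^+ 4) ^+ 3).
Proof.
have [m] := ubnP #|D|; elim: m D u v => // m IHm D u v.
rewrite ltnS => leD u0 v0.
have [->|[i iD]] := set_0Vmem D.
  have sub0 (f : {set T} -> R) : \sum_(X : {set T} | X \subset set0) f X = f set0.
    rewrite (eq_bigl (pred1 set0)) ?big_pred1_eq // => X.
    by rewrite subset0.
  rewrite !sub0 cards0 expr0 mul1r /noise big_set0 mulr1.
  have r4 x : 0 <= x -> root4 (x ^+ 4) = x.
    move=> x0; rewrite /root4 -[4%N]/(2 * 2)%N exprM sqrtr_sqr ger0_norm ?sqr_ge0 //.
    by rewrite sqrtr_sqr ger0_norm.
  by rewrite !r4.
rewrite -(setD1K iD); set E := D :\ i.
have iE : i \notin E by rewrite setD11.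
have ltE : (#|E| < m)%N by rewrite (cardsD1 i) iD in leD.
rewrite cardsU1 iE !big_subsetU1 //.
pose S (f g : {set T} -> R) := \sum_(X : {set T} | X \subset E)
  \sum_(Y : {set T} | Y \subset E) f X ^+ 3 * g Y ^+ 3 * noise E X Y.
pose u1 X := u (i |: X); pose v1 X := v (i |: X).
have -> : \sum_(X : {set T} | X \subset E)
     (\sum_(Y : {set T} | Y \subset i |: E) u X ^+ 3 * v Y ^+ 3 * noise (i |: E) X Y
      + \sum_(Y : {set T} | Y \subset i |: E)
          u (i |: X) ^+ 3 * v Y ^+ 3 * noise (i |: E) (i |: X) Y)
   = 2 * S u v + S u v1 + S u1 v + 2 * S u1 v1.
  rewrite /S !mulr_sumr -!big_split /=; apply: eq_bigr => X sX.
  rewrite !mulr_sumr !big_subsetU1 // -!big_split /=; apply: eq_bigr => Y sY.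
  have iX : i \notin X by apply: contra iE; exact: subsetP.
  have iY : i \notin Y by apply: contra iE; exact: subsetP.
  rewrite !noiseU1 // !noise_setU1l // !noise_setU1r //.
  rewrite !setU11 (negbTE iX) (negbTE iY) /= /u1 /v1; ring.
pose N (f : {set T} -> R) := \sum_(X : {set T} | X \subset E) f X ^+ 4.
have N0 f : (forall X, 0 <= f X) -> 0 <= N f.
  by move=> f0; apply: sumr_ge0 => X _; rewrite exprn_ge0.
have u10 X : 0 <= u1 X by exact: u0.
have v10 X : 0 <= v1 X by exact: v0.
have IH f g : (forall X, 0 <= f X) -> (forall X, 0 <= g X) ->
    S f g <= Num.sqrt (9 / 2) ^+ #|E| * (root4 (N f) ^+ 3 * root4 (N g) ^+ 3).
  by move=> f0 g0; exact: IHm.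
have -> : \sum_(X : {set T} | X \subset E) (u X ^+ 4 + u (i |: X) ^+ 4) = N u + N u1.
  exact: big_split.
have -> : \sum_(X : {set T} | X \subset E) (v X ^+ 4 + v (i |: X) ^+ 4) = N v + N v1.
  exact: big_split.
set c : R := Num.sqrt (9 / 2) ^+ #|E|.
have c0 : 0 <= c by rewrite exprn_ge0 ?sqrtr_ge0.
set a := root4 (N u); set b := root4 (N u1).
set x := root4 (N v); set y := root4 (N v1).
pose B := 2 * (a ^+ 3 * x ^+ 3) + a ^+ 3 * y ^+ 3 + b ^+ 3 * x ^+ 3
        + 2 * (b ^+ 3 * y ^+ 3).
apply: (@le_trans _ _ (c * B)).
  have := IH u v u0 v0; have := IH u v1 u0 v10.
  have := IH u1 v u10 v0; have := IH u1 v1 u10 v10.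
  rewrite -/c -/a -/b -/x -/y /B => h11 h10 h01 h00.
  have -> : c * (2 * (a ^+ 3 * x ^+ 3) + a ^+ 3 * y ^+ 3 + b ^+ 3 * x ^+ 3
        + 2 * (b ^+ 3 * y ^+ 3)) = 2 * (c * (a ^+ 3 * x ^+ 3))
    + c * (a ^+ 3 * y ^+ 3) + c * (b ^+ 3 * x ^+ 3) + 2 * (c * (b ^+ 3 * y ^+ 3)).
    by ring.
  by rewrite !lerD // ler_pM2l.
rewrite add1n [_ ^+ #|E|.+1]exprSr -/c -mulrA ler_wpM2l //.
have [a0 b0 x0 y0] : [/\ 0 <= a, 0 <= b, 0 <= x & 0 <= y].
  by split; exact: root4_ge0.
have aE : a ^+ 4 = N u by rewrite root4K ?N0.
have bE : b ^+ 4 = N u1 by rewrite root4K ?N0.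
have xE : x ^+ 4 = N v by rewrite root4K ?N0.
have yE : y ^+ 4 = N v1 by rewrite root4K ?N0.
have p0 := root4_ge0 (N u + N u1); have q0 := root4_ge0 (N v + N v1).
have pE : root4 (N u + N u1) ^+ 4 = a ^+ 4 + b ^+ 4.
  by rewrite aE bE root4K ?addr_ge0 ?N0.
have qE : root4 (N v + N v1) ^+ 4 = x ^+ 4 + y ^+ 4.
  by rewrite xE yE root4K ?addr_ge0 ?N0.
move: p0 q0 pE qE; move: (root4 (_ + _)) (root4 (_ + _)) => q p p0 q0 pE qE.
(* Fourth powers clear all roots and leave [two_point_form]. *)
rewrite -(@ler_pXn2r _ 4) // ?nnegrE; last first.
- by rewrite !mulr_ge0 ?exprn_ge0 ?sqrtr_ge0.
- by rewrite /B !addr_ge0 ?mulr_ge0 ?exprn_ge0.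
have := two_point_form a0 b0 x0 y0; rewrite -/B -pE -qE => h.
have s4 : Num.sqrt (9 / 2) ^+ 4 = 81 / 4 :> R.
  rewrite -[4%N]/(2 * 2)%N exprM sqr_sqrtr; first by field.
  by rewrite divr_ge0.
have -> : (Num.sqrt (9 / 2) * (p ^+ 3 * q ^+ 3)) ^+ 4
  = Num.sqrt (9 / 2) ^+ 4 * ((p ^+ 4) ^+ 3 * (q ^+ 4) ^+ 3) :> R by ring.
rewrite s4; lra.
Qed.

End Hypercontractivity.

(** * Fourier analysis of families and their influences *)

Section Fourier.
Variables (R : rcfType) (T : finType).
Implicit Types (f : {set T} -> R) (S X Y : {set T}) (P : {set {set T}}).

Definition chi S X : R := \prod_(j in S) (-1) ^+ (j \in X).

(** Unnormalised: [2 ^ #|T|] times the usual Fourier coefficient. *)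
Definition coef f S : R := \sum_(X : {set T}) f X * chi S X.

Lemma chiM S X Y :
  chi S X * chi S Y = \prod_(j in S) (-1) ^+ ((j \in X) (+) (j \in Y)).
Proof.
by rewrite /chi -big_split; apply: eq_bigr => j _ /=; rewrite signr_addb.
Qed.

Lemma chi_setU1 S X i : i \notin X -> chi S (i |: X) = (-1) ^+ (i \in S) * chi S X.
Proof.
move=> iX; have [iS|iS] := boolP (i \in S); last first.
  rewrite expr0 mul1r; apply: eq_bigr => j jS; rewrite !inE.
  by case: (eqVneq j i) jS iS => // -> ->.
rewrite /chi !(bigD1 i iS) /= setU11 (negbTE iX) expr0 mul1r; congr (_ * _).
by apply: eq_bigr => j /andP[_ ji]; rewrite !inE (negbTE ji).
Qed.

(** Expanding the product over [j] gives a sum over [S] of products of characters. *)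
Lemma sum_pow_coef (rho : R) f :
  \sum_(S : {set T}) rho ^+ #|S| * coef f S ^+ 2
    = \sum_(X : {set T}) \sum_(Y : {set T}) f X * f Y
        * \prod_j (1 + rho * (-1) ^+ ((j \in X) (+) (j \in Y))).
Proof.
have kernel X Y : \prod_j (1 + rho * (-1) ^+ ((j \in X) (+) (j \in Y)))
    = \sum_(S : {set T}) rho ^+ #|S| * (chi S X * chi S Y).
  under eq_bigr do rewrite addrC.
  rewrite bigA_distr; apply: eq_bigr => S _.
  rewrite chiM -prodr_const -big_split /= [RHS]big_mkcond /=.
  by apply: eq_bigr => j _; case: ifP.
under [RHS]eq_bigr => X _ do under eq_bigr => Y _ do rewrite kernel mulr_sumr.
under [RHS]eq_bigr do rewrite exchange_big /=.
rewrite [RHS]exchange_big /=; apply: eq_bigr => S _.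
rewrite expr2 /coef mulr_suml mulr_sumr; apply: eq_bigr => X _.
rewrite mulr_sumr mulr_sumr; apply: eq_bigr => Y _; ring.
Qed.

(** At [rho = 1] the kernel of [sum_pow_coef] vanishes unless [X = Y]. *)
Lemma parseval f :
  \sum_(S : {set T}) coef f S ^+ 2 = 2 ^+ #|T| * \sum_(X : {set T}) f X ^+ 2.
Proof.
transitivity (\sum_(S : {set T}) 1 ^+ #|S| * coef f S ^+ 2).
  by apply: eq_bigr => S _; rewrite expr1n mul1r.
rewrite sum_pow_coef mulr_sumr; apply: eq_bigr => X _.
rewrite (bigD1 X) //= [X in _ + X]big1 => [|Y neYX]; last first.
  have [j jXY] : exists j, (j \in X) != (j \in Y).
    apply/existsP; apply: contraNT neYX => /existsPn eqXY.
    by apply/eqP/setP => j; have := eqXY j; rewrite negbK => /eqP.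
  rewrite (bigD1 j) //= -negb_eqb jXY expr1 mul1r subrr mul0r mulr0 //.
under eq_bigr do rewrite addbb expr0 mulr1.
by rewrite prodr_const addr0 mulrC expr2.
Qed.

(** At [rho = 1 / 3] the factors 4/3 and 2/3 are 2/3 times the values 2 and 1 in [noise]. *)
Lemma sum_third_coef f :
  \sum_(S : {set T}) (1 / 3) ^+ #|S| * coef f S ^+ 2
    = (2 / 3) ^+ #|T| * \sum_(X : {set T}) \sum_(Y : {set T})
        f X * f Y * noise R [set: T] X Y.
Proof.
rewrite sum_pow_coef mulr_sumr; apply: eq_bigr => X _.
rewrite mulr_sumr; apply: eq_bigr => Y _.
have -> : \prod_j (1 + 1 / 3 * (-1) ^+ ((j \in X) (+) (j \in Y)))
    = (2 / 3) ^+ #|T| * noise R [set: T] X Y.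
  rewrite /noise [X in _ = _ * X](eq_bigl xpredT) => [|j]; last by rewrite inE.
  have -> : (2 / 3) ^+ #|T| = \prod_(j : T) (2 / 3) :> R by rewrite prodr_const.
  rewrite -big_split /=; apply: eq_bigr => j _.
  by rewrite -negb_eqb; case: (_ == _) => /=; field.
by rewrite mulrCA.
Qed.

(** The sign makes this the projection of [f] onto the characters [chi S] with [i \in S]. *)
Definition deriv (i : T) f X : R :=
  (-1) ^+ (i \in X) * ((f (X :\ i) - f (i |: X)) / 2).

Lemma coef_deriv i f S : coef (deriv i f) S = if i \in S then coef f S else 0.
Proof.
rewrite /coef !(big_set_split _ _ i) /=.
have -> : (if i \in S then
     \sum_(X : {set T} | i \notin X) (f X * chi S X + f (i |: X) * chi S (i |: X))
   else 0) = \sum_(X : {set T} | i \notin X) if i \in S then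
     (f X * chi S X + f (i |: X) * chi S (i |: X)) else 0.
  by case: (i \in S) => //; rewrite big1.
apply: eq_bigr => X iX; rewrite /deriv setU11 (negbTE iX) chi_setU1 //.
rewrite setU1K // setUA setUid.
have -> : X :\ i = X by apply/setDidPl; rewrite disjoint_sym disjoints1.
by case: (i \in S); rewrite ?expr0 ?expr1; field.
Qed.

Lemma sum_card_coef (rho : R) f :
  \sum_(S : {set T}) #|S|%:R * (rho ^+ #|S| * coef f S ^+ 2)
    = \sum_i \sum_(S : {set T}) rho ^+ #|S| * coef (deriv i f) S ^+ 2.
Proof.
rewrite exchange_big /=; apply: eq_bigr => S _.
under [RHS]eq_bigr do rewrite coef_deriv.
rewrite -sum1_card natr_sum mulr_suml big_mkcond /=.
by apply: eq_bigr => i _; case: ifP; rewrite ?mul1r // expr0n mulr0.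
Qed.

Definition ind P X : R := (X \in P)%:R.

Lemma norm_deriv_ind i P X : `|deriv i (ind P) X| = ind (pivotal i P) X / 2.
Proof.
rewrite normrM normr_sign mul1r /ind inE.
by case: (_ \in P); case: (_ \in P);
  rewrite /= ?subrr ?subr0 ?sub0r ?mul0r ?normr0 // ?mulNr ?normrN ger0_norm ?divr_ge0.
Qed.

Lemma sum_ind P : \sum_(X : {set T}) ind P X = #|P|%:R.
Proof.
by rewrite -sum1_card natr_sum [RHS]big_mkcond; apply: eq_bigr => X _; rewrite /ind; case: ifP.
Qed.

Lemma ind_exp P X k : ind P X ^+ k.+1 = ind P X.
Proof. by rewrite /ind; case: (X \in P); rewrite ?expr1n ?expr0n. Qed.

Lemma total_influence P :
  \sum_(S : {set T}) #|S|%:R * coef (ind P) S ^+ 2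
    = 2 ^+ #|T| / 4 * \sum_i #|pivotal i P|%:R.
Proof.
transitivity (\sum_(S : {set T}) #|S|%:R * (1 ^+ #|S| * coef (ind P) S ^+ 2)).
  by apply: eq_bigr => S _; rewrite expr1n mul1r.
rewrite sum_card_coef mulr_sumr; apply: eq_bigr => i _.
under eq_bigr do rewrite expr1n mul1r.
rewrite parseval -sum_ind !mulr_sumr; apply: eq_bigr => X _.
by rewrite -real_normK ?num_real // norm_deriv_ind expr_div_n ind_exp; field.
Qed.

(** Each derivative has absolute value half the indicator of [pivotal i P], whose powers equal
    itself, so [hypercontractive] applies to that indicator. Each coordinate contributes
    [2 / 3 * Num.sqrt (9 / 2) = Num.sqrt 2]. *)
Lemma sum_card_third_coef P :
  \sum_(S : {set T}) #|S|%:R * ((1 / 3) ^+ #|S| * coef (ind P) S ^+ 2)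
    <= Num.sqrt 2 ^+ #|T| / 4 * \sum_i Num.sqrt #|pivotal i P|%:R ^+ 3.
Proof.
rewrite sum_card_coef mulr_sumr; apply: ler_sum => i _.
rewrite sum_third_coef; set Q := pivotal i P.
have hyp := @hypercontractive R T [set: T] (ind Q) (ind Q)
   (fun X => ler0n _ _) (fun X => ler0n _ _).
have subT (f : {set T} -> R) : \sum_(X : {set T} | X \subset [set: T]) f X
    = \sum_(X : {set T}) f X.
  by apply: eq_bigl => X; rewrite subsetT.
move: hyp; rewrite !subT; under eq_bigr do rewrite subT.
under [X in root4 X]eq_bigr do rewrite ind_exp.
rewrite sum_ind cardsT => hyp.
have -> : Num.sqrt 2 ^+ #|T| / 4 * Num.sqrt #|Q|%:R ^+ 3
   = (2 / 3) ^+ #|T| * (4^-1 * (Num.sqrt (9 / 2) ^+ #|T|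
     * (root4 #|Q|%:R ^+ 3 * root4 #|Q|%:R ^+ 3))) :> R.
  have -> : Num.sqrt 2 = 2 / 3 * Num.sqrt (9 / 2) :> R.
    rewrite -[2 / 3 in RHS]ger0_norm ?divr_ge0 // -sqrtr_sqr -sqrtrM ?sqr_ge0 //.
    by congr Num.sqrt; field.
  have -> : root4 #|Q|%:R ^+ 3 * root4 #|Q|%:R ^+ 3 = Num.sqrt #|Q|%:R ^+ 3 :> R.
    by rewrite -exprMn -expr2 sqr_sqrtr ?sqrtr_ge0.
  by rewrite exprMn; ring.
rewrite ler_wpM2l ?exprn_ge0 ?divr_ge0 //.
apply: le_trans (_ : 4^-1 * (\sum_(X : {set T}) \sum_(Y : {set T})
   ind Q X ^+ 3 * ind Q Y ^+ 3 * noise R [set: T] X Y) <= _).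
  rewrite mulr_sumr; apply: ler_sum => X _.
  rewrite mulr_sumr; apply: ler_sum => Y _.
  have n0 : 0 <= noise R [set: T] X Y by apply: prodr_ge0 => j _; case: ifP.
  rewrite !ind_exp [leRHS]mulrA ler_wpM2r //.
  apply: le_trans (ler_norm _) _; rewrite normrM !norm_deriv_ind -/Q.
  by rewrite le_eqVlt; apply/orP; left; apply/eqP; field.
by rewrite ler_pM2l // invr_gt0.
Qed.

End Fourier.

(** * The Kahn-Kalai-Linial bound for the largest influence *)

Section KahnKalaiLinial.
Variables (R : realType) (T : finType).
Implicit Types P : {set {set T}}.

Lemma ln3_le : ln 3 <= 4 / 3 :> R.
Proof.
rewrite -ler_expR lnK ?posrE //.
have -> : 4 / 3 = 4%:R * (1 / 3) :> R by field.
rewrite expRM_natl; apply: (@le_trans _ _ ((1 + 1 / 3) ^+ 4)); first by lra.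
by rewrite ler_pXn2r ?nnegrE ?expR_ge1Dx ?expR_ge0 //; lra.
Qed.

(* Tangent line at tau / ln 3 of the convex function k |-> 3 ^ -k *)
Lemma third_exp_ge (tau : R) k :
  expR (- tau) * (1 + tau - ln 3 * k%:R) <= (1 / 3) ^+ k.
Proof.
have -> : (1 / 3) ^+ k = expR (- tau) * expR (tau - ln 3 * k%:R) :> R.
  rewrite -expRD addrA addNr add0r -mulNr expRM_natr expRN lnK ?posrE //.
  by rewrite div1r.
by rewrite ler_pM2l ?expR_gt0 // -addrA expR_ge1Dx.
Qed.

(** With [ln3_le], this gives [ln 3 <= 3 / 5 * Num.sqrt 5], as the choice of [tau] in
    [max_influence] requires. *)
Lemma sqrt5_ge : 20 / 9 <= Num.sqrt 5 :> R.
Proof.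
rewrite -(@ler_pXn2r _ 2) ?nnegrE ?sqrtr_ge0 ?divr_ge0 // sqr_sqrtr //; lra.
Qed.

(** Cube [2 * x <= expR x] at [x = 2 / 15 * L]; the constants leave room for strictness. *)
Lemma cube_lt_expR (L : R) : 0 <= L -> L ^+ 3 < 40 * Num.sqrt 5 * expR (2 / 5 * L).
Proof.
move=> L0; have s5 := sqrt5_ge.
have e1 : 2 * (2 / 15 * L) <= expR (2 / 15 * L).
  have -> : 2 / 15 * L = 1 + (2 / 15 * L - 1) by ring.
  rewrite expRD; have := expR_ge1Dx (2 / 15 * L - 1).
  have : 2 <= expR 1 :> R by apply: le_trans (expR_ge1Dx 1); lra.
  move=> h2 h; apply: ler_pM => //; lra.
have -> : 2 / 5 * L = 3%:R * (2 / 15 * L) by field.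
rewrite expRM_natl.
have e0 := expR_gt0 (2 / 15 * L); move: (expR _) e0 e1 => E E0 e1.
have E3 : (4 / 15 * L) ^+ 3 <= E ^+ 3.
  by rewrite ler_pXn2r // ?nnegrE; lra.
have E3' : 0 < E ^+ 3 by rewrite exprn_gt0.
have h : 800 / 9 * E ^+ 3 <= 40 * Num.sqrt 5 * E ^+ 3 by rewrite ler_pM2r //; lra.
have e3 : (4 / 15 * L) ^+ 3 = 64 / 3375 * L ^+ 3 by field.
rewrite e3 in E3; lra.
Qed.

(** Summing [third_exp_ge] over nonempty [S] gives at least [expR (- tau)] times [(1 + tau) * V -
    tau * 2 ^+ #|T| * #|P|%:R / 2], and [V] is at least [2 ^+ #|T| * #|P|%:R / 2] since [P] has
    density at most 1/2. *)
Lemma spectral_lower_bound P (tau : R) : 0 <= tau ->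
    (2 * #|P| <= 2 ^ #|T|)%N ->
    ln 3 * \sum_i #|pivotal i P|%:R <= 2 * tau * #|P|%:R ->
  expR (- tau) * (2 ^+ #|T| * #|P|%:R / 2)
    <= \sum_(S : {set T}) #|S|%:R * ((1 / 3) ^+ #|S| * coef (ind R P) S ^+ 2).
Proof.
move=> tau0 leP leI.
pose c S := coef (ind R P) S ^+ 2.
have c0 S : 0 <= c S by exact: sqr_ge0.
pose V := \sum_(S : {set T} | S != set0) c S.
have VE : V = 2 ^+ #|T| * #|P|%:R - #|P|%:R ^+ 2.
  have := parseval (ind R P); under [in RHS]eq_bigr do rewrite ind_exp.
  rewrite sum_ind (bigD1 set0) //= => <-.
  have -> : coef (ind R P) set0 = #|P|%:R.
    rewrite -sum_ind; apply: eq_bigr => X _.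
    by rewrite /chi big_set0 mulr1.
  by rewrite addrC addrK.
have IE : \sum_(S : {set T} | S != set0) #|S|%:R * c S
    = 2 ^+ #|T| / 4 * \sum_i #|pivotal i P|%:R.
  by rewrite -total_influence [RHS](bigD1 set0) //= cards0 mul0r add0r.
rewrite (bigD1 set0) //= cards0 mul0r add0r.
apply: (@le_trans _ _ (\sum_(S : {set T} | S != set0)
    expR (- tau) * ((1 + tau) * c S - ln 3 * (#|S|%:R * c S)))); last first.
  apply: ler_sum => S nzS; rewrite -/(c S).
  apply: (@le_trans _ _ ((1 / 3) ^+ #|S| * c S)).
    have -> : expR (- tau) * ((1 + tau) * c S - ln 3 * (#|S|%:R * c S))
      = expR (- tau) * (1 + tau - ln 3 * #|S|%:R) * c S by ring.
    by rewrite ler_wpM2r // third_exp_ge.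
  apply: ler_peMl; last by rewrite ler1n card_gt0.
  by rewrite mulr_ge0 ?c0 ?exprn_ge0 ?divr_ge0.
rewrite -mulr_sumr ler_wpM2l ?expR_ge0 // sumrB -!mulr_sumr IE -/V VE.
have g0 : 0 <= #|P|%:R :> R by [].
have : 2 * #|P|%:R <= 2 ^+ #|T| :> R by rewrite -natrX -natrM ler_nat.
move: (\sum_i _) leI => I leI; move: #|P|%:R g0 leI => g g0 leI.
have : 0 <= 2 ^+ #|T| :> R by rewrite exprn_ge0.
move: (2 ^+ _) => N N0 leg.
have h1 : N / 4 * (ln 3 * I) <= N / 4 * (2 * tau * g) by rewrite ler_wpM2l ?divr_ge0.
have h2 : 0 <= (1 + tau) * (g * (N - 2 * g)) by rewrite !mulr_ge0 //; lra.
lra.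
Qed.

(* If all influences are small, so is the total influence, and Jensen's
   inequality bounds the damped Fourier weight of P from below
   ([spectral_lower_bound]); hypercontractivity applied to the derivatives of P
   bounds it from above. *)
Lemma max_influence P : (0 < #|T|)%N -> (2 * #|P| <= 2 ^ #|T|)%N ->
  exists i : T, #|P|%:R * (ln #|T|%:R / (Num.sqrt 5 * #|T|%:R)) <= #|pivotal i P|%:R :> R.
Proof.
move=> T0 leP; apply/existsP; apply: contraT => /existsPn small.
set n : R := #|T|%:R in small *; set L := ln n in small.
have n0 : 0 < n by rewrite ltr0n.
have n1 : 1 <= n by rewrite ler1n.
have L0 : 0 <= L by rewrite ln_ge0.
have s5 := sqrt5_ge; have s50 : 0 < Num.sqrt 5 :> R by lra.
set m := #|P|%:R * _ in small.
have ltm i : #|pivotal i P|%:R < m by rewrite ltNge small.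
have m0 : 0 < m by case/card_gt0P: T0 => i _; exact: le_lt_trans (ltm i).
have g0 : 0 < #|P|%:R :> R.
  rewrite lt_neqAle ler0n andbT; apply: contraTneq m0 => eq0.
  by rewrite /m -eq0 mul0r ltxx.
have sumI : \sum_i #|pivotal i P|%:R <= n * m.
  rewrite mulr_natl -sumr_const; apply: ler_sum => i _; exact/ltW/ltm.
have nm : n * m = #|P|%:R * L / Num.sqrt 5 by rewrite /m; field; rewrite !gt_eqF.
(* [tau = 3 / 10 * L] makes [expR (- tau) ^+ 2 * n] equal to [expR (2 / 5 * L)], the quantity in
   [cube_lt_expR]. *)
have tau0 : 0 <= 3 / 10 * L by lra.
have leI : ln 3 * \sum_i #|pivotal i P|%:R <= 2 * (3 / 10 * L) * #|P|%:R.
  apply: (@le_trans _ _ (4 / 3 * (n * m))).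
    by apply: ler_pM; rewrite ?ln3_le ?ln_ge0 ?sumr_ge0 //; lra.
  rewrite nm [leLHS]mulrA ler_pdivrMr //.
  have : 0 <= #|P|%:R * L * (Num.sqrt 5 - 20 / 9) by rewrite !mulr_ge0 ?(ltW g0) //; lra.
  lra.
have := le_trans (spectral_lower_bound tau0 leP leI) (sum_card_third_coef R P).
have sumS : \sum_i Num.sqrt #|pivotal i P|%:R ^+ 3 <= n * Num.sqrt m ^+ 3.
  rewrite mulr_natl -sumr_const; apply: ler_sum => i _.
  rewrite ler_pXn2r ?nnegrE ?sqrtr_ge0 // ler_sqrt ?(ltW m0) //; exact/ltW/ltm.
move=> main; have {main} := le_trans main (ler_wpM2l _ sumS).
have q0 : 0 <= Num.sqrt 2 ^+ #|T| :> R by rewrite exprn_ge0 ?sqrtr_ge0.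
rewrite divr_ge0 // => /(_ isT).
set E := expR _; have E0 : 0 < E := expR_gt0 _.
have N0 : 0 < 2 ^+ #|T| :> R by rewrite exprn_gt0.
have gN : 2 * #|P|%:R <= 2 ^+ #|T| :> R by rewrite -natrX -natrM ler_nat.
have qN : (Num.sqrt 2 ^+ #|T|) ^+ 2 = 2 ^+ #|T| :> R.
  by rewrite -exprM mulnC exprM sqr_sqrtr.
have mE : Num.sqrt m ^+ 2 = m by rewrite sqr_sqrtr ?(ltW m0).
have rm0 := sqrtr_ge0 m.
move: (Num.sqrt 2 ^+ #|T|) (Num.sqrt m) q0 qN mE rm0 => q r q0 qN mE rm0.
have F_eq : expR (2 / 5 * L) = E ^+ 2 * n.
  by rewrite /E -expRM_natl -[n in RHS]lnK ?posrE // -/L -expRD; congr expR; field.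
move=> main; have := cube_lt_expR L0; rewrite F_eq ltNge => /negP[].
move: (2 ^+ #|T|) #|P|%:R N0 g0 gN qN nm main => N g N0 g0 gN qN nm main.
have {main} : (E * (N * g / 2)) ^+ 2 <= (q / 4 * (n * r ^+ 3)) ^+ 2.
  rewrite ler_pXn2r // ?nnegrE; last by rewrite !mulr_ge0 ?exprn_ge0 // ltW.
  by rewrite !mulr_ge0 ?ltW.
have -> : (q / 4 * (n * r ^+ 3)) ^+ 2 = q ^+ 2 / 16 * n ^+ 2 * (r ^+ 2) ^+ 3 by field.
rewrite qN mE => main.
have s2 : Num.sqrt 5 ^+ 2 = 5 :> R by rewrite sqr_sqrtr.
move: (Num.sqrt 5) s50 s2 nm => s s50 s2 nm.
(* Multiply the squared inequality by [16 * n * s ^+ 3] and eliminate [m] through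
   [n * m * s = g * L]. *)
have main2 : 4 * (E ^+ 2 * n) * N * s ^+ 3 * (N * g ^+ 2) <= g * L ^+ 3 * (N * g ^+ 2).
  have -> : g * L ^+ 3 * (N * g ^+ 2) = 16 * n * s ^+ 3 * (N / 16 * n ^+ 2 * m ^+ 3).
    have -> : g * L ^+ 3 * (N * g ^+ 2) = N * (g * L) ^+ 3 by ring.
    have -> : g * L = n * m * s by rewrite nm; field; rewrite gt_eqF.
    by field.
  have -> : 4 * (E ^+ 2 * n) * N * s ^+ 3 * (N * g ^+ 2)
    = 16 * n * s ^+ 3 * (E * (N * g / 2)) ^+ 2 by field.
  by rewrite ler_pM2l // !mulr_gt0 ?exprn_gt0.
rewrite ler_pM2r ?mulr_gt0 ?exprn_gt0 // in main2.
rewrite -(ler_pM2l g0); apply: le_trans main2.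
have -> : s ^+ 3 = 5 * s by rewrite exprS s2 mulrC.
(* Density at most 1/2 turns the remaining factor [N] into [2 * g], giving the constant 40 of
   [cube_lt_expR]. *)
have : 0 <= 20 * (E ^+ 2 * n * s) * (N - 2 * g).
  by rewrite mulr_ge0 ?subr_ge0 // !mulr_ge0 ?exprn_ge0 ?ltW.
lra.
Qed.

End KahnKalaiLinial.

(* hdeg excludes exactly the degenerate pairs (n, s), with s exponential in n,
   for which the bound exceeds 2 ^ n - 1 and so fails for every family that
   omits the empty set, as every saturated family does.  It holds whenever
   s <= n + 1; for s > n the family of all nonempty sets is the only
   s-saturated one. *)
Theorem theorem1p2 (R : realType) (n s : nat) (F : {set {set 'I_n}})
    (hn : (0 < n)%N) (hs : (2 <= s)%N)
    (hdeg : s%:R + (s%:R - 2) * (ln n%:R / (2 * Num.sqrt 5 * n%:R))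
            <= 2 ^+ n :> R)
    (hF : saturated s F) :
  #|F|%:R >=
    (1 - 1 / (s%:R + (s%:R - 2) * (ln n%:R / (2 * Num.sqrt 5 * n%:R))))
    * 2 ^+ n :> R.
Proof.
have n0 : 0 < n%:R :> R by rewrite ltr0n.
have s5 := sqrt5_ge R.
have L0 : 0 <= ln n%:R :> R by rewrite ln_ge0 // ler1n.
have eE : ln n%:R / (2 * Num.sqrt 5 * n%:R)
    = ln n%:R / (Num.sqrt 5 * n%:R) / 2 :> R by field; rewrite !gt_eqF //; lra.
have s2 : 2 <= s%:R :> R by rewrite ler_nat.
move: hdeg; set X := s%:R + _ => leX.
have X2 : 2 <= X.
  apply: (le_trans s2); rewrite lerDl mulr_ge0 ?subr_ge0 //.
    by rewrite divr_ge0 // !mulr_ge0 ?sqrtr_ge0.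
have X0 : 0 < X by lra.
have cF : #|F|%:R = 2 ^+ n - #|~: F|%:R :> R.
  rewrite -natrX; apply/eqP; rewrite eq_sym subr_eq -natrD cardsC.
  by rewrite -(cardsT {set 'I_n}) -powersetT card_powerset cardsT card_ord.
suff gX : #|~: F|%:R * X <= 2 ^+ n.
  have : #|~: F|%:R <= 2 ^+ n / X by rewrite ler_pdivlMr.
  rewrite cF mulrBl !mul1r [_ * 2 ^+ n]mulrC; lra.
(* If only [set0] is missing, the claim is [hdeg] itself. *)
have [[B nzB nFB]|allF] := pselect (exists2 B, B != set0 & B \notin F); last first.
  have -> : ~: F = [set set0].
    apply/setP => B; rewrite !inE; apply/idP/eqP => [nFB|->].
      by apply/eqP; apply: contraT => nzB; case: allF; exists B.
    exact: saturated_set0 hF.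
  by rewrite cards1 mul1r.
have bound i := saturated_influence_bound i hs hF nzB nFB.
have i0 : 'I_n := Ordinal hn.
(* Since [s >= 2], the bound already gives [~: F] density at most 1/2, so [max_influence] applies to
   it. *)
have gN : (2 * #|~: F| <= 2 ^ #|'I_n|)%N.
  rewrite card_ord -(@leq_pmul2l 2) //; apply: leq_trans (bound i0).
  by apply: leq_trans (leq_addr _ _); rewrite leq_mul2r hs orbT.
have T0 : (0 < #|'I_n|)%N by rewrite card_ord.
have [i] := max_influence R T0 gN.
rewrite card_ord pivotal_setC => piv.
have := bound i; rewrite -(ler_nat R) natrD !natrM natrX natrB // => bi.
(* Halving the combined inequality produces the 2 in the denominator [2 * Num.sqrt 5 * n%:R]. *)
have : (s%:R - 2) * (#|~: F|%:R * (ln n%:R / (Num.sqrt 5 * n%:R)))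
    <= (s%:R - 2) * #|pivotal i F|%:R :> R by rewrite ler_wpM2l ?subr_ge0.
rewrite /X eE; lra.
Qed.
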